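(* Assume that all dependencies are known ($U=\emptyset$) and that the repository, with $n$ packages, contains at most $d$ defects and at most $c$ unknown weak conflicts. Any non-adaptive algorithm that solves Full Learning must make at least $\mathcal S_{n,d+c-1,2}$ queries.
   Context: A repository consists of a finite set $P$ of $n$ packages, a set $K\subseteq P\times P$ of known dependencies, a set $U\subseteq P\times P$ of unknown dependencies, a set $C$ of unknown conflicts (unordered pairs of distinct packages), and a set $D\subseteq P$ of defects. A pair $(q,p)\in K\cup U$ means that $q$ depends on $p$: any installation including $q$ but not $p$ fails. The digraph $(P,K)$ is acyclic. An installation is a subset $I\subseteq P$; it is successful iff it contains no defect, contains $p$ whenever it contains $q$ with $(q,p)\in K\cup U$, and contains no two packages $p,q$ with $\{p,q\}\in C$. Defects are the packages that cannot be part of any successful installation; thus a package that depends on a defect is itself a defect, i.e. $((P\setminus D)\times D)\cap(K\cup U)=\emptyset$. Given two packages $p,q\in P$, $p$ weakly conflicts with $q$ if no successful installation includes both $p$ and $q$. An algorithm is given $P$, $K$ and the bounds $d,c$. A query is an installation $I\subseteq P$; an oracle answers whether it is successful. A non-adaptive algorithm computes its whole set of queries from its input and then computes its output from the answers. The cost is the number of queries. Full Learning: return the mixed graph whose vertices are the strongly connected components of the packages with the defective packages marked, together with all conflicts (here understood as weak conflicts) and all dependencies. With all dependencies known, this amounts to determining the defects and the pairs of packages that weakly conflict. An $(n,a,b)$-cover-free family (CFF) is a set $\mathcal F\subseteq\{0,1\}^n$ such that for all disjoint $S_1,S_2\subseteq\{1,\dots,n\}$ with $|S_1|=a$, $|S_2|=b$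 there is $v\in\mathcal F$ whose entries are all $0$ on $S_1$ and all $1$ on $S_2$. $\mathcal S_{n,a,b}$ denotes the minimal size of an $(n,a,b)$-CFF.
   Formalization: Proved for c ≥ 1, counting only weak conflicts between non-defects; for c = 0 the claim fails (n=4, d=3: the 4 dependency closures suffice, but S_{4,2,2}=6) or the index is -1 (d=0), and counting pairs with a defect would also make it false. *)

(* Defs.v *)
From mathcomp Require Import all_boot.

Set Implicit Arguments.
Unset Strict Implicit.
Unset Printing Implicit Defensive.

Section Repository.

Variable P : finType.

(* A pair (q, p) in [known] or [unknown] means that q depends on p.
   [conflicts] holds the unknown conflicts, as unordered pairs [set p; q]. *)
Record repository := Repository {
  known : {set P * P};
  unknown : {set P * P};
  conflicts : {set {set P}};
  defects : {set P}
}.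

Definition dependencies (R : repository) : {set P * P} := known R :|: unknown R.

Definition successful (R : repository) (I : {set P}) : bool :=
  [&& [disjoint I & defects R],
      [forall q, forall p, ((q, p) \in dependencies R) ==> (q \in I) ==> (p \in I)]
    & [forall p in I, forall q in I, [set p; q] \notin conflicts R]].

Definition acyclic (E : {set P * P}) : Prop :=
  forall q p, (q, p) \in E -> ~~ connect (fun x y => (x, y) \in E) p q.

(* The third clause makes the defects exactly the packages that are in no
   successful installation; in particular, a package that depends on a defect
   is a defect. *)
Definition well_formed (R : repository) : Prop :=
  [/\ acyclic (known R),
      forall e, e \in conflicts R -> #|e| = 2
    & forall p, (p \in defects R) = ~~ [exists I, successful R I && (p \in I)]].

Definition weakly_conflict (R : repository) (p q : P) : bool :=
  [forall I, successful R I ==> ~~ ((p \in I) && (q \in I))].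

(* A defect weakly conflicts with every package. Those pairs are accounted for
   by the defects, and are not counted as unknown weak conflicts. *)
Definition unknown_weak_conflicts (R : repository) : {set {set P}} :=
  [set [set p; q] | p in ~: defects R, q in ~: defects R
                  & (p != q) && weakly_conflict R p q].

Definition scc (R : repository) (p : P) : {set P} :=
  let e x y := (x, y) \in dependencies R in
  [set q | connect e p q && connect e q p].

Record mixed_graph := MixedGraph {
  vertices : {set {set P}};
  marked : {set P};
  edges : {set {set {set P}}};
  arcs : {set {set P} * {set P}}
}.

(* The conflict edges, unlike [unknown_weak_conflicts], include the pairs that
   contain a defect. *)
Definition full_graph (R : repository) : mixed_graph := {|
  vertices := [set scc R p | p in P];
  marked := defects R;
  edges := [set [set scc R p; scc R q] | p in P, q in P
               & (scc R p != scc R q) && weakly_conflict R p q];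
  arcs := [set (scc R u.1, scc R u.2) | u in dependencies R
              & scc R u.1 != scc R u.2] |}.

(* The arguments of [queries] are the known dependencies and the bounds d, c.
   [output] also receives the answers, given as the set of those queries that
   the oracle declared successful. *)
Record nonadaptive := Nonadaptive {
  queries : {set P * P} -> nat -> nat -> {set {set P}};
  output : {set P * P} -> nat -> nat -> {set {set P}} -> mixed_graph
}.

Definition answers (A : nonadaptive) (d c : nat) (R : repository) : {set {set P}} :=
  [set I in queries A (known R) d c | successful R I].

Definition cost (A : nonadaptive) (d c : nat) (R : repository) : nat :=
  #|queries A (known R) d c|.

Definition admissible (d c : nat) (R : repository) : Prop :=
  [/\ well_formed R, unknown R = set0, #|defects R| <= d
    & #|unknown_weak_conflicts R| <= c].

Definition solves_full_learning (A : nonadaptive) (d c : nat) : Prop :=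
  forall R, admissible d c R ->
    output A (known R) d c (answers A d c R) = full_graph R.

End Repository.

Section CoverFree.

Variables n a b : nat.

Definition is_cff (F : {set {ffun 'I_n -> bool}}) : bool :=
  [forall S1 : {set 'I_n}, forall S2 : {set 'I_n},
    [&& [disjoint S1 & S2], #|S1| == a & #|S2| == b] ==>
    [exists v in F, [forall i in S1, ~~ v i] && [forall i in S2, v i]]].

Lemma is_cff_setT : is_cff setT.
Proof.
apply/forallP=> S1; apply/forallP=> S2; apply/implyP=> /and3P[dS _ _].
apply/existsP; exists [ffun i => i \in S2]; rewrite inE /=; apply/andP; split.
  by apply/forallP=> i; apply/implyP=> iS1; rewrite ffunE (disjointFr dS iS1).
by apply/forallP=> i; apply/implyP=> iS2; rewrite ffunE.
Qed.

(* The minimum is over all families satisfying [is_cff]; [setT] only witnesses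
   that there is one. *)
Definition cff_size : nat := #|[arg min_(F < setT | is_cff F) #|F| ]|.

Lemma cff_size_min F : is_cff F -> cff_size <= #|F|.
Proof.
by rewrite /cff_size; case: arg_minnP => [|G _ minG]; [exact: is_cff_setT | exact: minG].
Qed.

Lemma cff_size_attained : exists2 F, is_cff F & #|F| = cff_size.
Proof.
by rewrite /cff_size; case: arg_minnP => [|G cffG _]; [exact: is_cff_setT | exists G].
Qed.

End CoverFree.

(* Main.v *)
(* Without dependencies, let C be a set of fewer than c conflicts.  Adding one
   more conflict {x, y} changes the output but only changes the answer to a
   query that contains x and y and is successful for C, so some query does.
   Splitting a given set of d + c - 1 packages into d defects and c - 1 packages
   that conflict with x yields a query containing x and y and avoiding that set:
   the queries made when K is empty form a cover-free family. *)
Require Import Defs.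
From mathcomp Require Import all_boot.

Set Implicit Arguments.
Unset Strict Implicit.
Unset Printing Implicit Defensive.

Section FlatRepository.

Variable P : finType.
Implicit Types (D I : {set P}) (C : {set {set P}}).

(** All these repositories share their known dependencies, so a non-adaptive algorithm makes the
    same queries on each of them. *)
Definition flat D C : repository P := Repository set0 set0 C D.

Lemma flat_dependencies D C : dependencies (flat D C) = set0.
Proof. exact: setU0. Qed.

Lemma flat_successful D C I :
  successful (flat D C) I =
    [disjoint I & D] && [forall p in I, forall q in I, [set p; q] \notin C].
Proof.
rewrite /successful flat_dependencies /=; congr (_ && _).
suff -> : [forall q, forall p, ((q, p) \in set0) ==> (q \in I) ==> (p \in I)] = true by [].
by apply/forallP=> q; apply/forallP=> p; rewrite inE.
Qed.

Lemma flat_scc D C p : scc (flat D C) p = [set p].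
Proof.
apply/setP=> q; rewrite !inE flat_dependencies; apply/idP/eqP=> [|->]; last first.
  by rewrite connect0.
by case/andP=> /connectP[[|y s] /=]; rewrite ?inE.
Qed.

Section Conflicts.

Variables (D : {set P}) (C : {set {set P}}).
Hypothesis card_conflict : forall e, e \in C -> #|e| = 2.

Lemma flat_successful2 p q :
  p \notin D -> q \notin D -> [set p; q] \notin C ->
  successful (flat D C) [set p; q].
Proof.
move=> pD qD pqC; rewrite flat_successful; apply/andP; split.
  by rewrite disjoints_subset; apply/subsetP=> x /set2P[] ->; rewrite inE.
(* The conflict test also ranges over equal packages, where the pair collapses to a singleton. *)
have loop x : [set x; x] \notin C.
  by apply/negP=> /card_conflict; rewrite setUid cards1.
by apply/forall_inP=> x /set2P[] ->; apply/forall_inP=> y /set2P[] ->;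
  rewrite ?loop // setUC.
Qed.

Lemma flat_weakly_conflict p q :
  p \notin D -> q \notin D ->
  weakly_conflict (flat D C) p q = ([set p; q] \in C).
Proof.
move=> pD qD; apply/idP/idP=> [/forallP/(_ [set p; q])|pqC].
  by rewrite set21 set22 implybF; apply: contraNT; exact: flat_successful2.
apply/forallP=> I; apply/implyP; rewrite flat_successful => /andP[_ indepI].
apply/negP=> /andP[pI qI].
by move/forall_inP: indepI => /(_ p pI)/forall_inP/(_ q qI); rewrite pqC.
Qed.

Lemma flat_well_formed : well_formed (flat D C).
Proof.
split=> [q p|//|p /=]; first by rewrite inE.
apply/idP/existsPn=> [pD I|nsucc].
  rewrite flat_successful; apply/negP=> /andP[/andP[dID _] pI].
  by rewrite (disjointFr dID pI) in pD.
apply/negPn/negP=> pD; have /negP[] := nsucc [set p; p].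
rewrite set21 flat_successful2 //.
by apply/negP=> /card_conflict; rewrite setUid cards1.
Qed.

Lemma flat_unknown_weak_conflicts : unknown_weak_conflicts (flat D C) \subset C.
Proof.
apply/subsetP=> _ /imset2P[p q + + ->]; rewrite !inE /= => pD /and3P[qD _].
by rewrite flat_weakly_conflict.
Qed.

Lemma flat_admissible d c : #|D| <= d -> #|C| <= c -> admissible d c (flat D C).
Proof.
move=> leDd leCc; split=> //; first exact: flat_well_formed.
exact: leq_trans (subset_leq_card flat_unknown_weak_conflicts) leCc.
Qed.

Lemma flat_full_graph_edge p q : p != q -> p \notin D -> q \notin D ->
  ([set [set p]; [set q]] \in edges (full_graph (flat D C))) = ([set p; q] \in C).
Proof.
move=> pq pD qD; rewrite -flat_weakly_conflict //=.
apply/imset2P/idP=> [[x y _ + /esym eq_xy]|wc]; last first.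
  exists p q => //; rewrite ?inE ?flat_scc // wc andbT /=.
  by rewrite (inj_eq set1_inj).
rewrite inE /= => /andP[_]; move: eq_xy; rewrite !flat_scc => eq_xy.
have: [set p] \in [set [set x]; [set y]] by rewrite eq_xy set21.
have: [set q] \in [set [set x]; [set y]] by rewrite eq_xy set22.
(* The unordered pairs may match straight or crossed; the crossed match uses the symmetry of weak
   conflict, and the other cases would force [p = q]. *)
rewrite !inE !(inj_eq set1_inj) => /pred2P[] eq_q /pred2P[] eq_p;
  rewrite -eq_q -?eq_p //; try by rewrite eq_p eq_q eqxx in pq.
by move/forallP=> qp; apply/forallP=> I; rewrite andbC.
Qed.

End Conflicts.

Section Learning.

Variables (A : nonadaptive P) (d c : nat).
Hypothesis hA : solves_full_learning A d c.

Lemma separating_query D C x y :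
    #|D| <= d -> #|C| < c -> (forall e, e \in C -> #|e| = 2) ->
    x != y -> x \notin D -> y \notin D -> [set x; y] \notin C ->
  exists I, [/\ I \in queries A set0 d c, successful (flat D C) I, x \in I & y \in I].
Proof.
move=> leD ltC cC xy xD yD xyC.
pose C' := [set x; y] |: C.
have cC' e : e \in C' -> #|e| = 2 by case/setU1P=> [->|/cC //]; rewrite cards2 xy.
have leC' : #|C'| <= c by rewrite cardsU1 xyC.
case: (boolP [exists I in queries A set0 d c,
    [&& successful (flat D C) I, x \in I & y \in I]]).
  by case/exists_inP=> I QI /and3P[]; exists I.
rewrite negb_exists => /forallP noI.
(* Enlarging [C] can only turn a success into a failure, and a query that newly fails contains [x]
   and [y], which [noI] excludes. *)
have eq_ans : answers A d c (flat D C) = answers A d c (flat D C').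
  apply/setP=> I; rewrite !inE /=; have [QI /=|//] := boolP (I \in _).
  move: (noI I); rewrite QI /= !flat_successful; case: [disjoint I & D] => //= noxy.
  apply/idP/idP=> /forall_inP indep; apply/forall_inP=> u uI;
    apply/forall_inP=> v vI; move/forall_inP: (indep u uI) => /(_ v vI);
    last by rewrite !inE negb_or => /andP[].
  rewrite !inE negb_or => ->; rewrite andbT; apply: contra noxy => /eqP uv.
  have inI w : w \in [set x; y] -> w \in I by rewrite -uv => /set2P[] ->.
  rewrite !inI ?set21 ?set22 // !andbT.
  by apply/forall_inP.
have := hA (flat_admissible cC leD (ltnW ltC)).
rewrite eq_ans (hA (flat_admissible cC' leD leC')).
(* The edge between [[set x]] and [[set y]] lies in exactly one of the two graphs. *)
move/(congr1 (fun G => [set [set x]; [set y]] \in edges G)).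
by rewrite !flat_full_graph_edge // setU11 (negPf xyC).
Qed.

Lemma avoiding_query (S : {set P}) x y :
    0 < c -> #|S| = d + c - 1 -> x != y -> x \notin S -> y \notin S ->
  exists I, [/\ I \in queries A set0 d c, [disjoint I & S], x \in I & y \in I].
Proof.
move=> c_gt0 cardS xy xS yS.
have le_dS : d <= #|S| by rewrite cardS -addnBA // leq_addr.
have /card_gt0P[D] : 0 < #|[set D : {set P} | D \subset S & #|D| == d]|.
  by rewrite cards_draws bin_gt0.
rewrite inE => /andP[sDS /eqP cardD].
(* Since [0 < c], the truncated subtraction is exact and [S :\: D] has [c - 1] elements, which
   leaves room for one more conflict. *)
pose C := [set [set x; t] | t in S :\: D].
have ltC : #|C| < c.
  apply: leq_ltn_trans (leq_imset_card _ _) _.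
  by rewrite cardsDS // cardS cardD -addnBA // addKn subn1 prednK.
have cC e : e \in C -> #|e| = 2.
  case/imsetP=> t /setDP[tS _] ->; rewrite cards2.
  by case: eqP tS xS => [->->|].
have xyC : [set x; y] \notin C.
  apply/imsetP=> -[t /setDP[tS _] eq_xt].
  have: y \in [set x; t] by rewrite -eq_xt set22.
  by case/set2P=> E; [rewrite E eqxx in xy | rewrite E tS in yS].
have nD z : z \notin S -> z \notin D by apply/contra/subsetP.
have [|I [QI sI xI yI]] := separating_query _ ltC cC xy (nD x xS) (nD y yS) xyC.
  by rewrite cardD.
(* A package of [S] in [I] would be a defect or conflict with [x], which is in [I]. *)
exists I; split=> //.
move: sI; rewrite flat_successful => /andP[dID /forall_inP/(_ x xI)/forall_inP noC].
rewrite disjoints_subset; apply/subsetP=> t tI; rewrite inE; apply/negP=> tS.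
case/negP: (noC t tI); apply: imset_f.
by rewrite inE tS andbT (disjointFr dID tI).
Qed.

End Learning.

End FlatRepository.

Theorem theorem8 (n : nat) (P : finType) (hP : #|P| = n) (d c : nat) (hc : 0 < c)
    (A : nonadaptive P) (hA : solves_full_learning A d c) :
  exists2 R : repository P, admissible d c R & cff_size n (d + c - 1) 2 <= cost A d c R.
Proof.
(* The cost depends on a repository only through its known dependencies, so this one stands for all
   flat ones. *)
exists (flat set0 set0); first by apply: flat_admissible => [e||]; rewrite ?inE ?cards0.
subst n; rewrite /cost /=.
(* Numbering the packages turns queries into 0/1 vectors, of which there are at most as many as
   queries. *)
pose indicator (I : {set P}) := [ffun i : 'I_#|P| => enum_val i \in I].
apply: leq_trans (leq_imset_card indicator _); apply: cff_size_min.
apply/forallP=> S1; apply/forallP=> S2; apply/implyP=> /and3P[dS /eqP cardS1].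
case/cards2P=> [i [j [ij eS2]]]; rewrite {}eS2 in dS *.
have nS1 k : k \in [set i; j] -> enum_val k \notin enum_val @: S1.
  by move=> kS2; rewrite (mem_imset _ _ enum_val_inj) (disjointFl dS kS2).
have [||||I [QI dI xI yI]] := @avoiding_query _ A d c hA
  (enum_val @: S1) (enum_val i) (enum_val j) hc.
- by rewrite card_imset //; exact: enum_val_inj.
- by rewrite (inj_eq enum_val_inj).
- by rewrite nS1 ?set21.
- by rewrite nS1 ?set22.
apply/exists_inP; exists (indicator I); first exact: imset_f.
apply/andP; split; apply/forall_inP=> k; rewrite ffunE.
  by move=> kS1; rewrite (disjointFl dI) // imset_f.
by case/set2P=> ->.
Qed.
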